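(* Let $L$ be a moment functional on $E$. Then the following are equivalent: (i) $L$ is not determinate. (ii) The family of vectors $(s_F(x))_{x\in W(L)}$ (indexed by the points of $W(L)$) is linearly dependent in $\mathbb{R}^m$. (iii) $|W(L)|>\dim\big(E|_{W(L)}\big)$. (iv) $L$ has a representing measure $\mu$ such that $|\operatorname{supp}\mu|>\dim\big(E|_{W(L)}\big)$.
   Context: $\mathcal X$ is a locally compact Hausdorff space, $E$ is a finite-dimensional vector space of real-valued continuous functions on $\mathcal X$, and $F=\{f_1,\dots,f_m\}$ is a fixed vector space basis of $E$. For $x\in\mathcal X$ put $s_F(x)=(f_1(x),\dots,f_m(x))^T\in\mathbb{R}^m$. A Radon measure on $\mathcal X$ is a (nonnegative) measure $\mu$ on the Borel $\sigma$-algebra with values in $[0,+\infty]$ such that $\mu(M)=\sup\{\mu(K):K\subseteq M,\ K\text{ compact}\}$ for every Borel set $M$. A linear functional $L$ on $E$ is a moment functional if there is a Radon measure $\mu$ on $\mathcal X$ such that all $f\in E$ are $\mu$-integrable and $L(f)=\int_{\mathcal X} f\,d\mu$ for all $f\in E$; any such $\mu$ is a representing measure of $L$, and $\mathcal M_L$ denotes the set of all representing measures of $L$. $L$ is determinate if $\mathcal M_L$ is a singleton. The set of atoms is $W(L)=\{x\in\mathcal X:\mu(\{x\})>0\text{ for some }\mu\in\mathcal M_L\}$. $E|_{W(L)}$ is the vector space of restrictions to $W(L)$ of the functions in $E$. *)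

(* Defs.v *)
From HB Require Import structures.
From mathcomp Require Import all_boot all_order all_algebra.
From mathcomp Require Import all_classical all_reals all_analysis.

Set Implicit Arguments.
Unset Strict Implicit.
Unset Printing Implicit Defensive.

Import Order.TTheory GRing.Theory Num.Theory.
Import numFieldNormedType.Exports.

Local Open Scope classical_set_scope.
Local Open Scope ring_scope.

Section LinearAlgebra.
Context {R : fieldType} {V : lmodType R}.

(* The index type may be infinite, so only finite sums over pairwise distinct
   indices are considered. Dependence is a property of the family, not of its
   range: a family taking the same value at two indices is dependent. *)
Definition lin_indep {I : choiceType} (v : I -> V) : Prop :=
  forall (s : seq I) (c : I -> R), uniq s ->
    \sum_(i <- s) c i *: v i = 0 -> forall i, i \in s -> c i = 0.

Definition lin_dep {I : choiceType} (v : I -> V) : Prop := ~ lin_indep v.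

Definition is_basis (S : set V) (n : nat) (b : 'I_n -> V) : Prop :=
  [/\ forall i, S (b i),
      lin_indep b &
      forall v, S v -> exists c : 'I_n -> R, v = \sum_(i < n) c i *: b i].

(* Meant for finite-dimensional subspaces; the value is 0 when S has no
   finite basis. *)
Definition lin_dim (S : set V) : nat :=
  xget 0%N [set n | exists b : 'I_n -> V, is_basis S b].

End LinearAlgebra.

Definition card_lt {T U : Type} (A : set T) (B : set U) : Prop :=
  (A #<= B)%card /\ ~ (B #<= A)%card.

Notation borelType X := (g_sigma_algebraType (@open X)).

Section Moments.
(* Measurable types are inhabited by construction, hence so is X; on the empty
   space there is only the zero measure. *)
Context {R : realType} {X : ptopologicalType}.
Implicit Types (mu nu : {measure set (borelType X) -> \bar R}).
(* A functional on E is a function on all of X -> R whose values outside E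
   are never used. *)
Implicit Types (E : set (X -> R)) (L : (X -> R) -> R).

(* No finiteness on compact sets is required. *)
Definition radon mu : Prop :=
  forall M : set (borelType X), measurable M ->
    mu M = ereal_sup [set mu K | K in [set K : set X | K `<=` M /\ compact K]].

Definition linear_functional E L : Prop :=
  forall (a : R) f g, E f -> E g -> L (a *: f + g) = a * L f + L g.

Definition representing E L : set {measure set (borelType X) -> \bar R} :=
  [set mu | radon mu /\
    forall f, E f ->
      mu.-integrable [set: borelType X] (fun x => (f x)%:E) /\
      (\int[mu]_(x in [set: borelType X]) (f x)%:E = (L f)%:E)%E].

Definition moment_functional E L : Prop :=
  linear_functional E L /\ representing E L !=set0.

(* Measures are identified when they agree on Borel sets: as library objects
   they also take (irrelevant) values on non-measurable sets. *)
Definition determinate E L : Prop :=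
  exists2 mu, representing E L mu &
    forall nu, representing E L nu ->
      forall A : set (borelType X), measurable A -> nu A = mu A.

Definition atoms E L : set X :=
  [set x | exists2 mu, representing E L mu & (0 < mu [set x])%E].

Definition msupp mu : set X :=
  [set x | forall U : set X, open U -> U x -> (0 < mu U)%E].

Definition restr_space (W : set X) E : set (W -> R) := [set sigL W f | f in E].

Definition moment_vec (m : nat) (F : 'I_m -> X -> R) (x : X) : 'cV[R]_m :=
  \col_i F i x.

End Moments.

Arguments restr_space {R X} W E.

(* Main.v *)
(* Let [s x] be the vector of values at [x] of the basis functions, [l] the vector
   of values of [L] on the basis, and call a direction [u] admissible if
   [l + e u] is, for some [e > 0], the moment vector of a Radon measure. The
   admissible directions form a convex cone, and a point [x] is an atom exactly
   when [- s x] is admissible. If [mu] represents [L], then both [int_A s dmu]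
   and its opposite are admissible for every Borel set [A]; these vectors thus
   lie in the lineality space of the cone, so [s x] lies in it for mu-almost
   every [x]. Hence every representing measure is carried by the set [W] of atoms.

   If [(s x)_(x in W)] is independent, every function on [W] is the restriction
   of some [f] in [E], so [mu A = L f] where [f] restricts to the indicator of
   [A], and [mu] is unique. If [sum_x c_x s x = 0] is a nontrivial relation,
   adding to a suitable measure Dirac masses at the points of the relation with
   weights [e], respectively [e + d c_x], gives two distinct representing
   measures. Since the admissible directions form a cone, any finitely many
   atoms are charged by a single representing measure, which relates [W] to the
   supports. *)
Require Import Defs.
From HB Require Import structures.
From mathcomp Require Import all_boot all_order all_algebra.
From mathcomp Require Import all_classical all_reals all_analysis.
From mathcomp Require Import measurable_realfun ring.

Set Implicit Arguments.
Unset Strict Implicit.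
Unset Printing Implicit Defensive.

Import Order.TTheory GRing.Theory Num.Theory.
Import numFieldNormedType.Exports.

Local Open Scope classical_set_scope.
Local Open Scope ring_scope.

(** * Cardinality and linear independence *)

Lemma infinite_ord_card_le T n (V : set T) : infinite_set V -> (`I_n #<= V)%card.
Proof. by move/infiniteP; exact/card_le_trans/subset_card_le. Qed.

(** With [ord_card_leP], this reduces strict comparison with [d] to exhibiting [d + 1] distinct
    points, whether or not [W] is finite. *)
Lemma card_lt_ord T (d : nat) (W : set T) :
  card_lt `I_d W <-> (`I_d.+1 #<= W)%card.
Proof.
split=> [[_ Wd]|dW]; last first.
  split; first by apply: card_le_trans dW; rewrite card_le_II.
  by move=> /(card_le_trans dW); rewrite card_le_II ltnn.
have [[n Wn]|] := pselect (finite_set W); last exact: infinite_ord_card_le.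
rewrite (card_le_eqr Wn) card_le_II ltnNge.
by apply/negP => nd; apply: Wd; rewrite (card_le_eql Wn) card_le_II.
Qed.

Lemma ord_card_leP (T : pointedType) (n : nat) (W : set T) :
  (`I_n #<= W)%card <-> exists t : 'I_n -> T, injective t /\ forall j, W (t j).
Proof.
rewrite (card_le_eql card_II); split=> [/pcard_leP[f]|[t [inj_t Wt]]].
  exists f; split=> [i j|j]; last exact: funS.
  by apply: (@inj _ _ _ f); rewrite inE.
have tW : range t `<=` W by move=> _ [j _ <-].
apply: card_le_trans (subset_card_le tW).
by rewrite (card_le_eqr (inj_card_eq _))//; exact: in2W.
Qed.

(** Among the matrices whose transposed rows lie in [U], one of maximal rank has row space [U]; its
    cokernel supplies the equations. *)
Lemma subspace_kernel (K : fieldType) (m : nat) (U : set 'cV[K]_m) :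
    U 0 -> (forall a u v, U u -> U v -> U (a *: u + v)) ->
  exists C : 'M[K]_m, (forall v, U v <-> C *m v = 0).
Proof.
move=> U0 UL.
have Ucomb (p : nat) (B : 'M[K]_(p, m)) (a : 'rV[K]_p) :
    (forall i, U (row i B)^T) -> U (a *m B)^T.
  move=> UB; rewrite mulmx_sum_row linear_sum/=.
  elim/big_ind: _ => [//|u v Uu Uv|i _]; first by rewrite -[u]scale1r; exact: UL.
  by rewrite linearZ/= -[_ *: _]addr0; exact: UL.
pose P k := `[< exists B : 'M[K]_m, \rank B = k /\ forall i, U (row i B)^T >].
have exP : exists k, P k.
  by exists 0%N; apply/asboolP;
  by exists 0; rewrite mxrank0; split=> // i; rewrite row0 trmx0.
have leP k : P k -> (k <= m)%N by move/asboolP => [B [<- _]]; exact: rank_leq_row.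
have [k /asboolP[B [rB UB]] kmax] := ex_maxnP exP leP.
have UP v : U v <-> (v^T <= B)%MS.
  split=> [Uv|/submxP[a vE]]; last by rewrite -[v]trmxK vE; exact: Ucomb.
  (* Joining [v^T] to the row space keeps it inside [U], so by maximality the rank does not grow and
     [v^T] was already there. *)
  have /kmax : P (\rank (B + v^T)%MS).
    apply/asboolP; exists (B + v^T)%MS; split=> // i.
    have /sub_addsmxP[[a b] ->/=] := row_sub i (B + v^T)%MS.
    rewrite linearD/= addrC -[X in X + _]scale1r; apply: UL; last exact: Ucomb.
    by apply: Ucomb => j; rewrite row_id trmxK.
  rewrite -rB => rBv; have /mxrank_leqif_sup := addsmxSl B v^T.
  move=> [le_r]; rewrite eqn_leq le_r rBv => /esym /(submx_trans (addsmxSr B v^T)).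
  exact.
exists (cokermx B)^T => v; rewrite UP submxE -{2}[v]trmxK -trmx_mul.
by split=> [/eqP ->|/(congr1 trmx)]; rewrite ?trmx0// trmxK => ->.
Qed.

Section LinIndep.
Context (K : fieldType) (I : choiceType) (m : nat) (v : I -> 'cV[K]_m).

Lemma lin_indep_row_free (n : nat) (t : 'I_n -> I) : injective t ->
  lin_indep v -> row_free (\matrix_(j < n) (v (t j))^T).
Proof.
move=> inj_t vI; apply: inj_row_free => u.
rewrite mulmx_sum_row => /(congr1 trmx); rewrite trmx0 linear_sum/= => u0.
(* [c] carries the coefficients over to [I] without an inverse of [t]; injectivity leaves a single
   term at [t j]. *)
pose c i := \sum_(j < n | t j == i) u 0 j.
have ct j : c (t j) = u 0 j.
  rewrite /c (big_pred1 j)// => k /=; exact: inj_eq.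
apply/rowP => j; rewrite mxE -ct; apply: (vI (map t (enum 'I_n))).
- by rewrite map_inj_uniq ?enum_uniq.
- rewrite big_map big_enum/= -[RHS]u0; apply: eq_bigr => k _.
  by rewrite ct linearZ/= rowK trmxK.
- by apply/mapP; exists j; rewrite ?mem_enum.
Qed.

Lemma row_free_lin_indep (n : nat) (t : 'I_n -> I) :
    injective t -> (forall i, exists j, t j = i) ->
  row_free (\matrix_(j < n) (v (t j))^T) -> lin_indep v.
Proof.
move=> inj_t surj_t tfree s c us cs.
have /row_free_inj inj_mul := tfree.
(* The values of [c] outside [s] are unconstrained, so they are replaced by 0 before the sum is
   extended to all indices. *)
pose u := \row_(j < n) (if t j \in s then c (t j) else 0).
have u0 : u = 0.
  apply: (inj_mul 1%N); rewrite mul0mx mulmx_sum_row -[LHS]trmxK linear_sum/=.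
  rewrite (_ : \sum_(j < n) _ = 0) ?trmx0//.
  have perm : perm_eq s [seq i <- map t (enum 'I_n) | i \in s].
    apply: uniq_perm => //; first by rewrite filter_uniq// map_inj_uniq ?enum_uniq.
    move=> i; rewrite mem_filter; have [j <-] := surj_t i.
    by rewrite map_f ?mem_enum// andbT.
  move: cs; rewrite (perm_big _ perm)/= big_filter big_map big_enum_cond/=.
  rewrite big_mkcond => cs; apply: etrans cs.
  apply: eq_bigr => j _; rewrite linearZ/= rowK trmxK mxE.
  by case: ifP; rewrite ?scale0r.
move=> i si; have [j ij] := surj_t i.
by have := congr1 (fun w : 'rV[K]_n => w 0 j) u0; rewrite !mxE ij si.
Qed.

End LinIndep.

Lemma finite_ord_enum (T : pointedType) (W : set T) : finite_set W ->
  exists n (t : 'I_n -> W), [/\ injective t, (forall w, exists j, t j = w) &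
    (W #= `I_n)%card].
Proof.
move=> [n Wn]; exists n.
have /card_set_bijP[f [Wf inj_f surj_f]] : ([set: 'I_n] #= W)%card.
  by rewrite -(card_eql card_II) card_eq_sym.
have Wf' j : f j \in W by apply/mem_set/Wf.
exists (fun j => SigSub (Wf' j)); split=> [i j /(congr1 set_val)/= fij|w|//].
  by apply: inj_f fij; rewrite inE.
have [j _ fj] := surj_f _ (set_valP w).
by exists j; apply/val_inj.
Qed.

(** * Dimension of the restriction space as a matrix rank *)

Section RestrSpace.
Context (R : realType) (X : ptopologicalType) (E : set (X -> R)).
Hypothesis vectE : GRing.submod_closed [in E].
Context (m : nat) (F : 'I_m -> X -> R).
Hypothesis basisF : is_basis E F.

Lemma basis_comb (s : seq 'I_m) (c : 'I_m -> R) : E (\sum_(i <- s) c i *: F i).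
Proof.
have [E0 EL] := vectE; have [EF _ _] := basisF.
elim/big_ind: _ => [|f g Ef Eg|i _].
- by move: E0; rewrite inE.
- by have := EL 1 f g; rewrite scale1r !inE; apply.
- by have := EL (c i) (F i) 0; rewrite addr0 !inE; apply => //; rewrite -inE.
Qed.

Lemma comb_moment_vec (c : 'I_m -> R) x :
  (\sum_i c i *: F i) x = ((\row_i c i) *m moment_vec F x) 0 0.
Proof. by rewrite fct_sumE mxE; apply: eq_bigr => i _; rewrite !mxE. Qed.

Variables (W : set X) (n : nat) (t : 'I_n -> W).
Hypothesis inj_t : injective t.
Hypothesis surj_t : forall w, exists j, t j = w.
(** The columns of [A] are the basis functions sampled on [W], so [rv] identifies the restriction
    space with the row space of [A^T]. *)
Let A : 'M[R]_(n, m) := \matrix_(j < n) (moment_vec F (set_val (t j)))^T.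
Let rv (g : W -> R) : 'rV[R]_n := \row_j g (t j).

Lemma restr_spaceP g : restr_space W E g <-> (rv g <= A^T)%MS.
Proof.
have rvE (c : 'I_m -> R) :
    rv (sigL W (\sum_i c i *: F i)) = (\row_i c i) *m A^T.
  apply/rowP => j; rewrite mxE /sigL/= comb_moment_vec !mxE.
  by apply: eq_bigr => i _; rewrite !mxE.
split=> [[f Ef <-]|/submxP[c gE]].
  have [_ _ /(_ f Ef)[c ->]] := basisF.
  by rewrite rvE submxMl.
exists (\sum_i c 0 i *: F i); first exact: basis_comb.
apply/funext => w; have [j <-] := surj_t w.
have := congr1 (fun u : 'rV[R]_n => u 0 j) (rvE (c 0)).
rewrite [LHS]mxE => ->.
have -> : \row_i c 0 i = c by apply/rowP => i; rewrite mxE.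
by rewrite -gE mxE.
Qed.

(** Sampling is injective, so bases correspond to row bases of [A^T]. As [lin_dim] is a choice by
    [xget], both parts are needed: a basis of this size exists, and every basis has this size. *)
Lemma lin_dim_restr_space : lin_dim (restr_space W E) = \rank A.
Proof.
have rv_sum d (b : 'I_d -> W -> R) (c : 'I_d -> R) :
    rv (\sum_i c i *: b i) = \row_i c i *m (\matrix_i rv (b i)).
  by apply/rowP => j; rewrite !mxE fct_sumE; apply: eq_bigr => i _; rewrite !mxE.
have rv_inj g h : rv g = rv h -> g = h.
  move=> gh; apply/funext => w; have [j <-] := surj_t w.
  by have := congr1 (fun u : 'rV[R]_n => u 0 j) gh; rewrite !mxE.
have rv0 : rv 0 = 0 by apply/rowP => j; rewrite !mxE.
rewrite -mxrank_tr; apply: xget_unique.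
- have [idx tK] := choice surj_t.
  pose b (k : 'I_(\rank A^T)) w := row_base A^T k (idx w).
  have rvb : \matrix_k rv (b k) = row_base A^T.
    apply/matrixP => k j; rewrite mxE [LHS]mxE /b; congr (fun_of_matrix _ k _).
    exact/inj_t/tK.
  exists b; split=> [k|s c us|g].
  + apply/restr_spaceP; have -> : rv (b k) = row k (row_base A^T).
      by rewrite -rvb rowK.
    by rewrite -(eq_row_base A^T) row_sub.
  + rewrite (big_uniq _ us) big_mkcond/= => cs i si.
    pose c' k := if k \in s then c k else 0.
    have : \row_k c' k = 0.
      have /row_free_inj inj_mul := row_base_free A^T.
      apply: (inj_mul 1%N); rewrite mul0mx -rvb -rv_sum -rv0.
      congr rv; apply: etrans cs; apply: eq_bigr => k _.
      by rewrite /c'; case: ifP; rewrite ?scale0r.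
    move/rowP => /(_ i); rewrite !mxE /c' si; exact.
  + move=> /restr_spaceP; rewrite -(eq_row_base A^T) => /submxP[c gE].
    exists (c 0); apply: rv_inj; rewrite rv_sum rvb gE; congr (_ *m _).
    by apply/rowP => i; rewrite mxE.
- move=> d [b [Eb bI Espan]].
  pose B : 'M[R]_(d, n) := \matrix_k rv (b k).
  have Bfree : row_free B.
    apply: inj_row_free => u uB.
    apply/rowP => k; rewrite mxE; apply: (bI (enum 'I_d) (u 0)).
    + exact: enum_uniq.
    + apply: rv_inj; rewrite big_enum/= rv_sum rv0 -[RHS]uB; congr (_ *m _).
      by apply/rowP => i; rewrite mxE.
    + by rewrite mem_enum.
  have -> : \rank A^T = \rank B; last by rewrite (eqP Bfree).
  apply/eqP; rewrite eqn_leq; apply/andP; split; apply: mxrankS.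
  + apply/row_subP => i.
    have [c /(congr1 rv)] : exists c : 'I_d -> R, sigL W (F i) = \sum_k c k *: b k.
      by apply: Espan; exists (F i) => //; case: basisF.
    rewrite rv_sum (_ : rv _ = row i A^T) => [->|]; first exact: submxMl.
    by apply/rowP => j; rewrite !mxE.
  + by apply/row_subP => k; rewrite rowK; apply/restr_spaceP.
Qed.

End RestrSpace.

(** * Independence of the moment vectors on a set of points *)

Section LinIndepRestr.
Context (R : realType) (X : ptopologicalType) (E : set (X -> R)).
Hypothesis vectE : GRing.submod_closed [in E].
Context (m : nat) (F : 'I_m -> X -> R) (basisF : is_basis E F) (W : set X).
Let sW (x : W) := moment_vec F (set_val x).

(** Otherwise [m + 1] points of [W] would give a matrix of rank [m + 1] with [m] columns. *)
Lemma lin_indep_finite : lin_indep sW -> finite_set W.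
Proof.
move=> sI; apply: contrapT => /(infinite_ord_card_le m.+1).
move=> /ord_card_leP[t [inj_t Wt]].
pose t' j : W := SigSub (mem_set (Wt j)).
have inj_t' : injective t' by move=> i j /(congr1 set_val)/inj_t.
have := lin_indep_row_free inj_t' sI; rewrite /row_free => /eqP rm.
by have := rank_leq_col (\matrix_j (sW (t' j))^T); rewrite rm ltnn.
Qed.

(** Free rows of the sampling matrix make its transpose full, so every vector of values on [W] is
    attained. *)
Lemma lin_indep_interpolation (g : X -> R) : lin_indep sW ->
  exists2 f, E f & forall x, W x -> f x = g x.
Proof.
move=> sI; have [n [t [inj_t surj_t _]]] := finite_ord_enum (lin_indep_finite sI).
have [|f Ef fg] := (restr_spaceP vectE basisF surj_t (sigL W g)).2.
  apply: submx_full; rewrite /row_full mxrank_tr.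
  exact: (lin_indep_row_free inj_t sI).
exists f => // x /mem_set Wx.
by have := congr1 (fun h => h (SigSub Wx)) fg.
Qed.

(** The dimension is the rank of a matrix with one row per point of [W], and the rows are
    independent exactly when the rank reaches their number. *)
Lemma lin_indep_card :
  lin_indep sW <-> ~ card_lt `I_(lin_dim (restr_space W E)) W.
Proof.
rewrite card_lt_ord; split=> [sI|nlt].
  have [n [t [inj_t surj_t Wn]]] := finite_ord_enum (lin_indep_finite sI).
  rewrite (lin_dim_restr_space vectE basisF inj_t surj_t) (card_le_eqr Wn).
  by rewrite (eqP (lin_indep_row_free inj_t sI)) card_le_II ltnn.
(* An infinite [W] exceeds every natural number, whatever the value of [lin_dim]. *)
have Wfin : finite_set W by apply: contrapT => /infinite_ord_card_le.
have [n [t [inj_t surj_t Wn]]] := finite_ord_enum Wfin.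
apply: (row_free_lin_indep inj_t surj_t).
move: nlt; rewrite (lin_dim_restr_space vectE basisF inj_t surj_t) (card_le_eqr Wn).
rewrite card_le_II => /negP; rewrite -leqNgt => le_n.
by rewrite /row_free eqn_leq le_n rank_leq_row.
Qed.

End LinIndepRestr.

(** * Integrals with respect to sums, multiples and restrictions of measures *)

Section HasIntegral.
Context d (T : measurableType d) (R : realType).
Implicit Types (mu : {measure set T -> \bar R}) (f : T -> R).
Local Open Scope ereal_scope.

Definition has_integral mu f (r : R) : Prop :=
  mu.-integrable setT (EFin \o f) /\ \int[mu]_x (f x)%:E = r%:E.

Lemma has_integral_measure_add mu nu f r s :
  has_integral mu f r -> has_integral nu f s ->
  has_integral (measure_add mu nu) f (r + s)%R.
Proof.
move=> [if1 e1] [if2 e2]; have mf := measurable_int _ if1; split.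
  have [_ l1] := integrableP _ _ _ if1; have [_ l2] := integrableP _ _ _ if2.
  apply/integrableP; split=> //; rewrite ge0_integral_measure_add//.
    exact: lte_add_pinfty.
  exact: measurableT_comp.
by rewrite integral_measure_add// e1 e2 EFinD.
Qed.

Lemma has_integral_mscale mu f r (k : {nonneg R}) :
  has_integral mu f r -> has_integral (mscale k mu) f (k%:num * r)%R.
Proof.
move=> [if1 e1]; have mf := measurable_int _ if1; split.
  have [_ l1] := integrableP _ _ _ if1.
  apply/integrableP; split=> //; rewrite ge0_integral_mscale//.
    exact: lte_mul_pinfty.
  exact: measurableT_comp.
(* The positive and negative parts are scaled separately; integrability allows the factor to be
   distributed over their difference. *)
move: e1; rewrite integralE => e1.
rewrite integralE !ge0_integral_mscale//.
- rewrite EFinM -e1 [in RHS]muleBr//.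
  exact: (integrable_add_def measurableT if1).
- exact: measurable_funeneg.
- exact: measurable_funepos.
Qed.

Lemma has_integral_dirac f (a : T) : measurable_fun setT f ->
  has_integral \d_a f (f a).
Proof.
move=> /measurable_EFinP mf; split.
  apply/integrableP; split=> //; rewrite integral_dirac//.
    by rewrite diracT mul1e ltry.
  exact: measurableT_comp.
by rewrite integral_dirac//= diracT mul1e.
Qed.

(** The restricted measure agrees with [mu] on subsets of [A] and with the zero measure on subsets
    of the complement. *)
Lemma ge0_integral_mrestr mu (A : set T) (mA : measurable A) (f : T -> \bar R) :
  measurable_fun setT f -> (forall x, 0 <= f x) ->
  \int[mrestr mu mA]_x f x = \int[mu]_(x in A) f x.
Proof.
move=> mf f0; have mCA := measurableC mA.
rewrite -(setvU A) ge0_integral_setU ?setvU//; last first.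
  by apply/disj_setPS => x [].
rewrite (_ : \int[_]_(x in ~` A) _ = 0) ?add0e; last first.
  rewrite -(integral_measure_zero (~` A) f).
  apply: eq_measure_integral => B mB BA.
  move: BA; rewrite -disjoints_subset => BA.
  by rewrite /= /mrestr BA measure0.
apply: eq_measure_integral => B mB BA.
by rewrite /= /mrestr setIidl.
Qed.

Lemma has_integral_mrestr mu (A : set T) (mA : measurable A) f :
  mu.-integrable setT (EFin \o f) ->
  has_integral (mrestr mu mA) f (\int[mu]_(x in A) f x)%R.
Proof.
move=> if1; have mf := measurable_int _ if1.
have if2 : mu.-integrable A (EFin \o f) by exact: integrableS if1.
split.
  have [_ l1] := integrableP _ _ _ if2.
  apply/integrableP; split=> //; rewrite ge0_integral_mrestr//.
  exact: measurableT_comp.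
rewrite integralE !ge0_integral_mrestr//.
- by rewrite -integralE /Rintegral fineK//; apply: integrable_fin_num.
- exact: measurable_funeneg.
- exact: measurable_funepos.
Qed.
End HasIntegral.

Lemma has_integral_sum d (T : measurableType d) (R : realType)
    (mu : {measure set T -> \bar R}) (I : Type) (s : seq I) (f : I -> T -> R)
    (r : I -> R) :
  (forall i, has_integral mu (f i) (r i)) ->
  has_integral mu (fun x => \sum_(i <- s) f i x) (\sum_(i <- s) r i).
Proof.
move=> fr; have sumE : EFin \o (fun x => \sum_(i <- s) f i x) =
    (fun x => \sum_(i <- s) (f i x)%:E)%E.
  by apply/funext => x /=; rewrite sumEFin.
split; first by rewrite sumE; apply: integrable_sum => // i _; have [] := fr i.
rewrite -[LHS]/(\int[mu]_x (EFin \o (fun x => \sum_(i <- s) f i x)%R) x)%E sumE.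
rewrite integral_sum//; last by move=> i; have [] := fr i.
by rewrite -sumEFin; apply: eq_bigr => i _; have [] := fr i.
Qed.

Lemma has_integralZ d (T : measurableType d) (R : realType)
    (mu : {measure set T -> \bar R}) (a : R) (f : T -> R) r :
  has_integral mu f r -> has_integral mu (fun x => a * f x) (a * r).
Proof.
move=> [fi fr]; split; first exact: (integrableZl measurableT a fi).
under eq_integral do rewrite EFinM.
by rewrite integralZl// fr EFinM.
Qed.

Lemma has_integral_setC d (T : measurableType d) (R : realType)
    (mu : {measure set T -> \bar R}) (A : set T) (f : T -> R) r :
    measurable A -> has_integral mu f r ->
  \int[mu]_(x in ~` A) f x = r - \int[mu]_(x in A) f x.
Proof.
move=> mA [fi fr]; have mCA := measurableC mA.
have fiA : mu.-integrable A (EFin \o f) by exact: integrableS fi.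
have fiC : mu.-integrable (~` A) (EFin \o f) by exact: integrableS fi.
have finA := integrable_fin_num mA fiA; have finC := integrable_fin_num mCA fiC.
move: fr; rewrite -(setvU A) integral_setU//.
- rewrite -[X in (X + _)%E]fineK// -[X in (_ + X)%E]fineK// -EFinD => -[<-].
  by rewrite /Rintegral addrK.
- by rewrite setvU; exact: measurable_int fi.
- by apply/disj_setPS => x [].
Qed.

(** A point may have infinite mass; finiteness of [f x * mu [set x]] then forces [f x = 0]. *)
Lemma has_integral_set1 d (T : measurableType d) (R : realType)
    (mu : {measure set T -> \bar R}) (f : T -> R) r (x : T) :
    measurable [set x] -> has_integral mu f r ->
  (mu [set x] = +oo%E -> f x = 0) /\
  \int[mu]_(y in [set x]) f y = f x * fine (mu [set x]).
Proof.
move=> mx [fi fr].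
have fix1 : mu.-integrable [set x] (EFin \o f) by exact: integrableS fi.
have e : (\int[mu]_(y in [set x]) (f y)%:E = (f x)%:E * mu [set x])%E.
  rewrite -integral_cst//; apply: eq_integral => y; rewrite inE => ->//.
have fin_e : ((f x)%:E * mu [set x])%E \is a fin_num.
  by rewrite -e; exact: integrable_fin_num.
have ioo : mu [set x] = +oo%E -> f x = 0.
  move=> muoo; move: fin_e; rewrite muoo.
  have [fx|fx|//] := ltgtP (f x) 0.
    by rewrite lt0_muley ?lte_fin// fin_numE.
  by rewrite gt0_muley ?lte_fin.
split=> //; rewrite /Rintegral e.
have [mufin|] := boolP (mu [set x] \is a fin_num); first by rewrite fineM.
(* [fine] sends [+oo] to 0, which is harmless because [f x = 0] here. *)
rewrite ge0_fin_numE// -leNgt leye_eq => /eqP /[dup] /ioo ->.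
by rewrite mul0e mul0r.
Qed.

(** * Radon measures *)

Section Radon.
Context {R : realType} {X : ptopologicalType} (hausX : hausdorff_space X).
Implicit Types (mu nu : {measure set (borelType X) -> \bar R}).

Lemma closed_borel (A : set (borelType X)) : @closed X A -> measurable A.
Proof.
move=> clA; rewrite -(setCK A); apply: measurableC.
by apply: sub_sigma_algebra; exact: closed_openC.
Qed.

Lemma compact_borel (A : set (borelType X)) : @compact X A -> measurable A.
Proof. by move=> cA; apply: closed_borel; exact: compact_closed. Qed.

Lemma borel_set1 (x : borelType X) : measurable [set x].
Proof. by apply: compact_borel; exact: compact_set1. Qed.

Lemma continuous_borel (f : X -> R) : continuous f ->
  measurable_fun setT (f : borelType X -> R).
Proof.
move=> /continuousP cf; apply: (measurability _ (RGenOpens.measurableE R)).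
move=> _ [_ [a [b ->] <-]]; rewrite setTI; apply: sub_sigma_algebra.
exact/cf/interval_open.
Qed.

Local Open Scope ereal_scope.


(** Compact sets approximating [M] for [mu] and for [nu] can be replaced by their union, so the two
    suprema can be taken independently. *)
Lemma radon_measure_add mu nu : radon mu -> radon nu -> radon (measure_add mu nu).
Proof.
have addE A : (measure_add mu nu : {measure set (borelType X) -> \bar R}) A = mu A + nu A.
  exact: measure_addE.
move=> rmu rnu M mM; rewrite addE; set S := ereal_sup _.
have KS K : K `<=` M -> compact K -> mu K + nu K <= S.
  by move=> KM cK; apply: ereal_sup_ubound; exists K; [split|rewrite addE].
have KKS K1 K2 : K1 `<=` M -> compact K1 -> K2 `<=` M -> compact K2 ->
    mu K1 + nu K2 <= S.
  move=> KM1 cK1 KM2 cK2; have cU := compactU cK1 cK2.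
  apply: le_trans (KS (K1 `|` K2) _ cU); last by rewrite subUset.
  have [m1 m2 m3] := And3 (compact_borel cK1) (compact_borel cK2) (compact_borel cU).
  by apply: leeD; apply: le_measure; rewrite ?inE//.
apply/eqP; rewrite eq_le; apply/andP; split; last first.
  apply/ereal_supP => _ [K [KM cK] <-]; rewrite addE.
  have mK := compact_borel cK.
  by apply: leeD; apply: le_measure; rewrite ?inE.
have S0 : 0 <= S by apply: le_trans (KS set0 _ compact0) => //; rewrite !measure0 adde0.
(* An infinite [S] bounds everything; a finite one makes the masses finite, so that they can be
   moved across inequalities. *)
have [Sfin|] := boolP (S \is a fin_num); last first.
  by rewrite ge0_fin_numE// -leNgt leye_eq => /eqP ->; exact: leey.
have muS : mu M <= S.
  rewrite (rmu M mM); apply/ereal_supP => _ [K [KM cK] <-].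
  by apply: le_trans (KKS K set0 KM cK _ compact0) => //; rewrite measure0 adde0.
have mufin : mu M \is a fin_num.
  by rewrite ge0_fin_numE//; apply: le_lt_trans muS _; rewrite -ge0_fin_numE.
rewrite addeC -leeBrDr// (rnu M mM); apply/ereal_supP => _ [K2 [KM2 cK2] <-].
have nuK2 : nu K2 \is a fin_num.
  rewrite ge0_fin_numE//; apply: (@le_lt_trans _ _ S); last by rewrite -ge0_fin_numE.
  by apply: le_trans (KKS set0 K2 _ compact0 KM2 cK2) => //; rewrite measure0 add0e.
rewrite leeBrDr// addeC -leeBrDr// (rmu M mM); apply/ereal_supP => _ [K1 [KM1 cK1] <-].
by rewrite leeBrDr//; exact: KKS.
Qed.

Lemma radon_mscale (k : {nonneg R}) mu : radon mu -> radon (mscale k mu).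
Proof.
move=> rmu M mM; rewrite /= /mscale rmu// -ereal_supZl//; last first.
  by apply/set0P; exists (mu set0), set0 => //; split=> //; exact: compact0.
by rewrite image_comp.
Qed.

Lemma radon_dirac (x : borelType X) : radon (\d_x : {measure set (borelType X) -> \bar R}).
Proof.
move=> M mM; apply/eqP; rewrite eq_le; apply/andP; split; last first.
  apply/ereal_supP => _ [K [KM cK] <-].
  by apply: le_measure => //; rewrite inE//; exact: compact_borel.
have [xM|xM] := boolP (x \in M).
  apply: ereal_sup_ubound; exists [set x]; last by rewrite /= !diracE xM mem_set.
  split; first by move=> _ ->; exact: set_mem.
  exact: compact_set1.
rewrite /= diracE (negbTE xM); apply: ereal_sup_ubound; exists set0; rewrite ?measure0//.
by split=> //; exact: compact0.
Qed.

Lemma radon_mrestr mu (A : set (borelType X)) (mA : measurable A) :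
  radon mu -> radon (mrestr mu mA).
Proof.
move=> rmu M mM; apply/eqP; rewrite eq_le; apply/andP; split; last first.
  apply/ereal_supP => _ [K [KM cK] <-].
  by apply: le_measure => //; rewrite inE//; exact: compact_borel.
rewrite /= /mrestr rmu; last exact: measurableI.
apply/ereal_supP => _ [K [KM cK] <-]; apply: ereal_sup_ubound; exists K.
  by split=> // x /KM[].
by congr (mu _); apply/setIidPl => x /KM[].
Qed.

End Radon.

(** * Moment vectors of Radon measures *)

Section Moments.
Context (R : realType) (X : ptopologicalType) (hausX : hausdorff_space X).
Context (m : nat) (F : 'I_m -> X -> R).
Hypothesis contF : forall i, continuous (F i).
Implicit Types (mu nu : {measure set (borelType X) -> \bar R}) (u v : 'cV[R]_m).

Local Notation borel_dirac x := (@dirac _ (borelType X) x R).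

Definition moments mu v : Prop :=
  radon mu /\ forall i, has_integral mu (F i) (v i 0).

Lemma moments_measure_add mu nu u v :
  moments mu u -> moments nu v -> moments (measure_add mu nu) (u + v).
Proof.
move=> [rmu mu_u] [rnu nu_v]; split; first exact: radon_measure_add.
by move=> i; rewrite mxE; exact: has_integral_measure_add.
Qed.

Lemma moments_mscale (k : {nonneg R}) mu v :
  moments mu v -> moments (mscale k mu) (k%:num *: v).
Proof.
move=> [rmu mu_v]; split; first exact: radon_mscale.
by move=> i; rewrite mxE; exact: has_integral_mscale.
Qed.

Lemma moments_dirac (x : X) : moments (borel_dirac x) (moment_vec F x).
Proof.
split; first exact: radon_dirac.
by move=> i; rewrite mxE; apply: has_integral_dirac; exact: continuous_borel.
Qed.

Definition moments_on mu (A : set X) : 'cV[R]_m :=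
  \col_i \int[mu]_(x in (A : set (borelType X))) F i x.

Lemma moments_mrestr mu v (A : set (borelType X)) (mA : measurable A) :
  moments mu v -> moments (mrestr mu mA) (moments_on mu A).
Proof.
move=> [rmu mu_v]; split; first exact: radon_mrestr.
by move=> i; rewrite mxE; apply: has_integral_mrestr; have [] := mu_v i.
Qed.

Lemma moments_on_setC mu v (A : set (borelType X)) : measurable A ->
  moments mu v -> moments_on mu (~` A) = v - moments_on mu A.
Proof.
move=> mA [_ mu_v]; apply/colP => i; rewrite !mxE.
exact: has_integral_setC.
Qed.

Lemma moments_on_set1 mu v (x : X) : moments mu v ->
  (mu [set x] = +oo%E -> moment_vec F x = 0) /\
  moments_on mu [set x] = fine (mu [set x]) *: moment_vec F x.
Proof.
have mx := @borel_set1 _ hausX x.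
move=> [_ mu_v]; split; last first.
  by apply/colP => i; rewrite !mxE mulrC; have [] := has_integral_set1 mx (mu_v i).
move=> muoo; apply/colP => i; rewrite !mxE.
by have [/(_ muoo)] := has_integral_set1 mx (mu_v i).
Qed.

(** Infinite mass at [x] forces a zero moment vector there, so deleting the point keeps the moments.
    A finite mass can later be cancelled. *)
Lemma moments_finite_set1 mu v (x : X) : moments mu v ->
  exists2 nu, moments nu v & (nu [set x] < +oo)%E.
Proof.
move=> mu_v; have mx := @borel_set1 _ hausX x.
have [muoo|] := eqVneq (mu [set x]) +oo%E; last by rewrite -ltey; exists mu.
exists (mrestr mu (measurableC mx)); last by rewrite /= /mrestr setICr measure0.
have := moments_mrestr (measurableC mx) mu_v.
rewrite (moments_on_setC mx mu_v).
by have [/(_ muoo) sx0 ->] := moments_on_set1 x mu_v; rewrite sx0 scaler0 subr0.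
Qed.

(** The explicit masses serve to compare measures at a point. The weights [w] are constrained only
    along [s], where the perturbed weights are known to be nonnegative. *)
Lemma moments_sum_dirac mu v (I : eqType) (s : seq I) (p : I -> X) (w : I -> R) :
    moments mu v -> (forall i, i \in s -> 0 <= w i) ->
  exists2 nu, moments nu (v + \sum_(i <- s) w i *: moment_vec F (p i)) &
    forall A, nu A = (mu A + \sum_(i <- s) (w i)%:E * borel_dirac (p i) A)%E.
Proof.
move=> mu_v; elim: s => [_|i s IH w0].
  exists mu; first by rewrite big_nil addr0.
  by move=> A; rewrite big_nil adde0.
have [|nu nu_v nuE] := IH; first by move=> j js; apply: w0; rewrite inE js orbT.
have wi0 : 0 <= w i by apply: w0; rewrite mem_head.
exists (measure_add nu (mscale (NngNum wi0) (borel_dirac (p i)))).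
  rewrite big_cons [_ *: _ + _]addrC addrA.
  exact: moments_measure_add nu_v (moments_mscale _ (moments_dirac (p i))).
move=> A; rewrite big_cons [(_ * _ + _)%E]addeC addeA -nuE.
exact: measure_addE.
Qed.

(** The cone of admissible directions, with base point [v]. *)
Definition moment_dir v : set 'cV[R]_m :=
  [set u | exists2 e, 0 < e & exists mu, moments mu (v + e *: u)].

Lemma moment_dir0 v : (exists mu, moments mu v) -> moment_dir v 0.
Proof. by exists 1; rewrite ?ltr01// scaler0 addr0. Qed.

Lemma moment_dirZ v u a : (exists mu, moments mu v) ->
  0 <= a -> moment_dir v u -> moment_dir v (a *: u).
Proof.
move=> v0; rewrite le_eqVlt => /predU1P[<- _|a0 [e e0 [mu mu_u]]].
  by rewrite scale0r; exact: moment_dir0.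
exists (e / a); first by rewrite divr_gt0.
by exists mu; rewrite scalerA divfK// gt_eqF.
Qed.

Lemma moment_dirD v u w : moment_dir v u -> moment_dir v w ->
  moment_dir v (u + w).
Proof.
move=> [e e0 [mu mu_u]] [f f0 [nu nu_w]].
have ef0 : 0 < e + f by rewrite addr_gt0.
(* Each measure is weighted by the step of the other: the weights sum to 1, and both directions get
   the coefficient [e * f / (e + f)]. *)
have k0 : 0 <= f / (e + f) by rewrite ltW// divr_gt0.
have h0 : 0 <= e / (e + f) by rewrite ltW// divr_gt0.
exists (e * f / (e + f)); first by rewrite divr_gt0// mulr_gt0.
exists (measure_add (mscale (NngNum k0) mu) (mscale (NngNum h0) nu)).
have := moments_measure_add (moments_mscale (NngNum k0) mu_u)
  (moments_mscale (NngNum h0) nu_w).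
congr moments; apply/colP => i; rewrite !mxE/=.
by field; rewrite gt_eqF.
Qed.

Lemma moment_dir_sum v (I : Type) (s : seq I) (u : I -> 'cV[R]_m) :
    (exists mu, moments mu v) -> (forall i, moment_dir v (u i)) ->
  moment_dir v (\sum_(i <- s) u i).
Proof.
move=> v0 vu; elim/big_ind: _ => //; first exact: moment_dir0.
by move=> *; exact: moment_dirD.
Qed.

(** With step 1, doubling the mass on [A] gives one direction and deleting it gives the opposite
    one. *)
Lemma moment_dir_on v mu (A : set (borelType X)) : measurable A -> moments mu v ->
  moment_dir v (moments_on mu A) /\ moment_dir v (- moments_on mu A).
Proof.
move=> mA mu_v; split; exists 1 => //; rewrite scale1r.
  exists (measure_add mu (mrestr mu mA)).
  exact: moments_measure_add (moments_mrestr mA mu_v).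
exists (mrestr mu (measurableC mA)).
by rewrite -(moments_on_setC mA mu_v); exact: moments_mrestr mu_v.
Qed.

(** A Dirac mass at [x] makes up for the step taken; conversely, deleting the point [x] from [mu]
    takes a step of length [mu [set x]]. If that mass is infinite, the direction is zero. *)
Lemma moment_dirNP v x : moment_dir v (- moment_vec F x) <->
  exists2 mu, moments mu v & (0 < mu [set x])%E.
Proof.
split=> [[e e0 [mu mu_v]]|[mu mu_v mux]].
  exists (measure_add mu (mscale (NngNum (ltW e0)) (borel_dirac x))).
    have := moments_measure_add mu_v
      (moments_mscale (NngNum (ltW e0)) (moments_dirac x)).
    by rewrite /= -addrA -scalerDr addNr scaler0 addr0.
  rewrite [ltRHS]measure_addE.
  apply: (lt_le_trans _ (leeDr _ (measure_ge0 mu _))).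
  by rewrite /= /mscale/= diracE mem_set//= mule1 lte_fin.
have mx := @borel_set1 _ hausX x.
have [muoo|muoo] := eqVneq (mu [set x]) +oo%E.
  have [/(_ muoo) -> _] := moments_on_set1 x mu_v.
  by rewrite (oppr0 'cV[R]_m); apply: moment_dir0; exists mu.
exists (fine (mu [set x])); first by rewrite fine_gt0// mux ltey.
exists (mrestr mu (measurableC mx)).
rewrite scalerN; have [_ <-] := moments_on_set1 x mu_v.
by rewrite -(moments_on_setC mx mu_v); exact: moments_mrestr mu_v.
Qed.

End Moments.

(** * Representing measures are carried by the atoms *)

Section Support.
Context (R : realType) (X : ptopologicalType) (hausX : hausdorff_space X).
Context (m : nat) (F : 'I_m -> X -> R).
Implicit Types (mu nu : {measure set (borelType X) -> \bar R}) (u v : 'cV[R]_m).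

Lemma moments_comb mu v (c : 'I_m -> R) : moments F mu v ->
  has_integral mu (fun x => \sum_i c i * F i x) (\sum_i c i * v i 0).
Proof.
by move=> [_ mu_v]; apply: has_integral_sum => i; apply: has_integralZ (mu_v i).
Qed.

Lemma negligible_moment_dirN mu v : moments F mu v ->
  mu.-negligible [set x | ~ moment_dir F v (- moment_vec F x)].
Proof.
move=> mu_v; have v0 : exists nu, moments F nu v by exists mu.
(* [U] is the lineality space of the cone; the rows of [C] below are linear equations for it. *)
pose U := [set u | moment_dir F v u /\ moment_dir F v (- u)].
have U0 : U 0 by split; rewrite ?(oppr0 'cV[R]_m); exact: moment_dir0.
have UL a u w : U u -> U w -> U (a *: u + w).
  move=> [u1 u2] [w1 w2]; rewrite /U/= opprD.
  (* A negative scalar exchanges the two conditions defining [U]. *)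
  have [a0|/ltW a0] := leP 0 a.
    by split; apply: moment_dirD => //; rewrite -?scalerN; exact: moment_dirZ.
  have -> : a *: u = (- a) *: (- u) by rewrite scalerN scaleNr opprK.
  rewrite -[X in _ /\ moment_dir _ _ (X - _)]scalerN opprK.
  by split; apply: moment_dirD => //; apply: moment_dirZ => //; rewrite oppr_ge0.
have [C UC] := subspace_kernel U0 UL.
pose h j x := \sum_i C j i * F i x.
have h0 j : ae_eq mu setT (EFin \o h j) (cst 0%E).
  have hi : mu.-integrable setT (EFin \o h j) by have [] := moments_comb (C j) mu_v.
  (* The integral of [h j] over [A] is row [j] of [C] applied to [moments_on F mu A], which lies in
     [U]. *)
  apply: integral_ae_eq => // A _ mA.
  have hiA : mu.-integrable A (EFin \o h j) by exact: integrableS hi.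
  rewrite integral0 -[LHS]fineK; last exact: integrable_fin_num.
  have [_ <-] := has_integral_mrestr mA hi.
  have [_ ->] := moments_comb (C j) (moments_mrestr hausX mA mu_v).
  have /UC/colP/(_ j) : U (moments_on F mu A) by exact: (moment_dir_on hausX mA mu_v).
  by rewrite !mxE => ->.
have : \forall x \ae mu, forall j, h j x = 0.
  by apply: filter_forall => j; apply: filterS (h0 j) => x /(_ Logic.I)[].
apply: negligibleS => x /= nx hx; apply: nx.
suff [] : U (moment_vec F x) by [].
apply/UC/colP => j; rewrite !mxE -[RHS](hx j).
by apply: eq_bigr => i _; rewrite mxE.
Qed.
End Support.

(** * Atoms and determinacy *)

Section Determinacy.
Context (R : realType) (X : ptopologicalType) (hausX : hausdorff_space X).
Context (E : set (X -> R)) (vectE : GRing.submod_closed [in E]).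
Hypothesis contE : forall f, E f -> continuous f.
Context (m : nat) (F : 'I_m -> X -> R) (basisF : is_basis E F).
Context (L : (X -> R) -> R) (momL : moment_functional E L).
Implicit Types mu nu : {measure set (borelType X) -> \bar R}.
Let W := atoms E L.
Let sW (x : W) := moment_vec F (set_val x).
Let l : 'cV[R]_m := \col_i L (F i).

Let contF i : continuous (F i).
Proof. by apply: contE; case: basisF. Qed.

Lemma functional_comb (s : seq 'I_m) (c : 'I_m -> R) :
  L (\sum_(i <- s) c i *: F i) = \sum_(i <- s) c i * L (F i).
Proof.
have [linL _] := momL; have [EF _ _] := basisF.
elim: s => [|i s IH]; last first.
  by rewrite !big_cons linL ?IH//; exact: basis_comb.
rewrite !big_nil; have E0 : E 0 by case: vectE; rewrite inE.
(* Additivity at 0 reads [L 0 = L 0 + L 0], whence [L 0 = 0]. *)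
have := linL 1 0 0 E0 E0; rewrite scale1r addr0 mul1r => /eqP.
by rewrite -subr_eq subrr => /eqP.
Qed.

(** Linearity reduces the condition on [E] to the basis, so [L] can be replaced by the vector
    [l]. *)
Lemma representing_moments mu : representing E L mu <-> moments F mu l.
Proof.
split=> [[rmu muE]|mu_l].
  by split=> // i; rewrite mxE; apply: muE; case: basisF.
split=> [|f Ef]; first by case: mu_l.
have [_ _ /(_ f Ef)[c ->]] := basisF.
have -> : \sum_i c i *: F i = (fun x => \sum_i c i * F i x).
  by apply/funext => x; rewrite fct_sumE.
have -> : L (fun x => \sum_i c i * F i x) = \sum_i c i * l i 0.
  transitivity (L (\sum_i c i *: F i)).
    by congr L; apply/funext => x; rewrite fct_sumE.
  by rewrite functional_comb; apply: eq_bigr => i _; rewrite mxE.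
exact: moments_comb.
Qed.

Lemma atomsE x : W x <-> moment_dir F l (- moment_vec F x).
Proof.
rewrite (moment_dirNP hausX contF).
by split=> -[mu /representing_moments]; exists mu.
Qed.

(** This yields one [e > 0] for which weight [e] at all the listed atoms can be split off
    simultaneously. *)
Lemma moment_dir_atoms (I : Type) (s : seq I) (p : I -> X) :
  (forall i, W (p i)) ->
  moment_dir F l (- \sum_(i <- s) moment_vec F (p i)).
Proof.
move=> Wp; have [_ [mu /representing_moments mu_l]] := momL.
rewrite -sumrN; apply: (moment_dir_sum hausX); first by exists mu.
by move=> i; apply/atomsE.
Qed.

Lemma negligible_atomsC mu : representing E L mu -> mu.-negligible (~` W).
Proof.
move=> /representing_moments mu_l.
apply: (negligibleS _ (negligible_moment_dirN hausX mu_l)) => x /= nWx.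
by move=> /atomsE.
Qed.

Lemma lin_indep_determinate : lin_indep sW -> determinate E L.
Proof.
move=> sI; have [_ [mu mu_L]] := momL; exists mu => // nu nu_L A mA.
have [f Ef f1] := lin_indep_interpolation vectE basisF \1_A sI.
(* The value [L f] does not depend on [rho], and [f] equals the indicator of [A] on [W], hence
   [rho]-almost everywhere. *)
suff fE rho : representing E L rho -> rho A = (L f)%:E by rewrite !fE.
move=> rho_L; have [_ /(_ f Ef)[fi <-]] := rho_L.
rewrite -[in LHS](setIT A) -integral_indic//; apply: ae_eq_integral => //.
- exact/measurable_EFinP/measurable_indic.
- exact: measurable_int fi.
apply: (negligibleS _ (negligible_atomsC rho_L)) => x /= nfx Wx; apply: nfx => _.
by rewrite f1.
Qed.

Lemma determinate_lin_indep : determinate E L -> lin_indep sW.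
Proof.
move=> [mu mu_L mu_unique] s c us cs k ks.
have [e e0 [nu' nu'_l]] := moment_dir_atoms s (@set_valP _ W).
have [nu nu_l nu_fin] := moments_finite_set1 hausX (set_val k) nu'_l.
set p : W -> X := set_val in nu'_l nu_l nu_fin.
pose S := \sum_(i <- s) `|c i|.
have S1 : 0 < 1 + S by rewrite ltr_pwDl// sumr_ge0.
(* Since [S] bounds every [-c i] with [i] in [s], this keeps [e + d * c i] nonnegative; the 1 keeps
   the denominator positive. *)
pose d := e / (1 + S).
have d0 : 0 < d by rewrite divr_gt0.
have w0 i : i \in s -> 0 <= e + d * c i.
  move=> si; have -> : e = d * (1 + S) by rewrite divfK// gt_eqF.
  rewrite -mulrDr mulr_ge0 ?(ltW d0)// -addrA addr_ge0// addrC -[S]opprK subr_ge0.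
  rewrite lerNl (le_trans (ler_norm _))// normrN /S (bigD1_seq i)//=.
  by rewrite lerDl sumr_ge0.
have massE (w : W -> R) :
    (\sum_(i <- s) (w i)%:E * @dirac _ (borelType X) (p i) R [set p k] = (w k)%:E)%E.
  rewrite (bigD1_seq k)//= diracE mem_set//= mule1 big1 ?adde0// => i ik.
  rewrite diracE memNset ?mule0// => /val_inj /eqP; exact/negP.
(* Weights whose excess over [e] is a linear relation restore the moments [l]; uniqueness then fixes
   the resulting mass at [p k]. *)
have addsE (w : W -> R) : (forall i, i \in s -> 0 <= w i) ->
    \sum_(i <- s) (w i - e) *: moment_vec F (p i) = 0 ->
    (nu [set p k] + (w k)%:E = mu [set p k])%E.
  move=> wge0 we0.
  have [mu1 mu1_l mu1E] := moments_sum_dirac hausX contF p nu_l wge0.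
  rewrite -(massE w) -mu1E; apply: mu_unique; last exact: borel_set1.
  apply/representing_moments; move: mu1_l; congr moments.
  rewrite -addrA scalerN scaler_sumr [- _ + _]addrC -sumrB.
  by under eq_bigr do rewrite -scalerBl; rewrite we0 addr0.
(* Comparing the perturbed weights with the constant [e] gives [d * c k = 0]. *)
have := addsE (fun i => e + d * c i) w0.
rewrite -(addsE (fun=> e)); last 2 first.
- by move=> *; exact: ltW.
- by rewrite big1// => i _; rewrite subrr scale0r.
have -> : \sum_(i <- s) (e + d * c i - e) *: moment_vec F (p i) = 0.
  under eq_bigr do rewrite addrC addKr -scalerA.
  by rewrite -scaler_sumr cs scaler0.
have nuk : nu [set p k] \is a fin_num by rewrite ge0_fin_numE.
move=> /(_ erefl); rewrite -(fineK nuk) -!EFinD => -[/addrI/eqP].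
rewrite -subr_eq0 addrC addKr mulf_eq0 gt_eqF//= => /eqP.
exact.
Qed.

(** A single measure charges [n + 1] chosen atoms, and a charged point lies in the support. *)
Lemma card_lt_atoms_msupp n : card_lt `I_n W ->
  exists2 mu, representing E L mu & card_lt `I_n (msupp mu).
Proof.
rewrite card_lt_ord => /ord_card_leP[t [inj_t Wt]].
have [e e0 [nu nu_l]] := moment_dir_atoms (enum 'I_n.+1) Wt.
have e_ge0 i : i \in enum 'I_n.+1 -> 0 <= e by move=> _; exact: ltW.
have [mu mu_l muE] := moments_sum_dirac hausX contF t nu_l e_ge0.
exists mu.
  apply/representing_moments; move: mu_l.
  by rewrite -scaler_sumr -addrA scalerN addNr addr0.
rewrite card_lt_ord; apply/ord_card_leP; exists t; split=> // j U oU Ut.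
have mt := @borel_set1 _ hausX (t j).
apply: (@lt_le_trans _ _ (mu [set t j])); last first.
  apply: le_measure; rewrite ?inE//; last by move=> _ ->.
  exact: sub_sigma_algebra.
rewrite muE (bigD1_seq j) ?mem_enum ?enum_uniq//= diracE mem_set//= mule1.
apply: lt_le_trans (leeDr _ (measure_ge0 nu _)).
apply: (@lt_le_trans _ _ e%:E); first by rewrite lte_fin.
by apply: leeDl; apply: sume_ge0 => i _; rewrite mule_ge0// lee_fin ltW.
Qed.

(** A finite [W] is closed, so its complement is an open null set and contains no support point. *)
Lemma msupp_sub_atoms mu : representing E L mu -> finite_set W -> msupp mu `<=` W.
Proof.
move=> mu_L Wfin x mux; apply: contrapT => nWx.
have oW : open (~` W).
  by apply/closed_openC/(compact_closed hausX)/finite_compact.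
have := mux _ oW nWx.
have -> : mu (~` W) = 0%E.
  apply/negligibleP; last exact: negligible_atomsC.
  exact: sub_sigma_algebra.
by rewrite ltxx.
Qed.

End Determinacy.

Theorem theorem18 (R : realType) (X : ptopologicalType)
    (hausX : hausdorff_space X) (lcX : locally_compact [set: X])
    (E : set (X -> R)) (vectE : GRing.submod_closed [in E])
    (contE : forall f, E f -> continuous f)
    (m : nat) (F : 'I_m -> X -> R) (basisF : is_basis E F)
    (L : (X -> R) -> R) (momL : moment_functional E L) :
  let W := atoms E L in
  [<-> ~ determinate E L;
       lin_dep (fun x : W => moment_vec F (set_val x));
       card_lt `I_(lin_dim (restr_space W E)) W;
       exists2 mu, representing E L mu &
         card_lt `I_(lin_dim (restr_space W E)) (msupp mu)].
Proof.
move=> W; have indepP := lin_indep_card vectE basisF W.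
have indep_det := lin_indep_determinate hausX vectE contE basisF momL.
have det_indep := determinate_lin_indep hausX vectE contE basisF momL.
tfae.
- exact: contra_not indep_det.
- by move=> ndep; apply: contrapT => /indepP.
- exact: (card_lt_atoms_msupp hausX vectE contE basisF momL).
(* Determinacy makes [W] finite, so the support lies in [W], which is then too large for
   independence. *)
- move=> [mu mu_L ltmu] /det_indep indepW; apply: (indepP.1 indepW).
  have Wfin := lin_indep_finite indepW.
  move: ltmu; rewrite !card_lt_ord => /card_le_trans; apply.
  apply: subset_card_le.
  exact: (msupp_sub_atoms hausX vectE contE basisF momL mu_L Wfin).
Qed.
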